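(* Let $n\ge 1$ and let $G$ be a simple edge-coloured graph with $n$ vertices and $n$ colours in which every colour class has size at least $3$. Then $G$ contains a rainbow cycle of length at most $\frac{4n}{9}+7$. Equivalently, $f(n,n,3)\le \frac{4n}{9}+7$.
   Context: Graphs may contain loops and parallel edges. An edge-coloured graph is simple if no colour class (set of edges of one colour) contains two parallel edges. A subgraph is rainbow if no two of its edges have the same colour; a loop is a cycle of length 1 and two parallel edges form a cycle of length 2. $f(n,t,r)$ denotes the maximum length of a shortest rainbow cycle (or $\infty$ if none exists) over all simple edge-coloured graphs with $n$ vertices, at least $t$ colours, and all colour classes of size at least $r$. *)

(* Defs.v *)
From mathcomp Require Import all_boot.
Set Implicit Arguments. Unset Strict Implicit. Unset Printing Implicit Defensive.

Section ColouredMultigraph.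
Variables (V E C : finType).
(* Each edge e has endpoints [ends e] (an unordered pair, represented by an
   ordered pair; a loop has both endpoints equal) and colour [col e]. *)
Variables (ends : E -> V * V) (col : E -> C).

Definition joins (e : E) (u v : V) : Prop :=
  ends e = (u, v) \/ ends e = (v, u).

Definition parallel (e1 e2 : E) : Prop :=
  e1 <> e2 /\ joins e2 (ends e1).1 (ends e1).2.

Definition simple_coloured : Prop :=
  forall e1 e2 : E, col e1 = col e2 -> ~ parallel e1 e2.

Definition colours_used : {set C} := [set c | [exists e, col e == c]].

Definition colour_class (c : C) : {set E} := [set e | col e == c].

(* G contains a rainbow cycle of length k (k >= 1): distinct vertices
   v_0..v_{k-1} and edges e_0..e_{k-1} with e_i joining v_i and v_{i+1 mod k},
   the edges having pairwise distinct colours.  Length 1 = loop, length 2 =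
   two parallel edges. *)
Definition has_rainbow_cycle_of_length (k : nat) : Prop :=
  0 < k /\
  exists (vs : nat -> V) (es : nat -> E),
    {in [pred i | i < k] &, injective vs} /\
    {in [pred i | i < k] &, injective (fun i => col (es i))} /\
    (forall i, i < k -> joins (es i) (vs i) (vs (i.+1 %% k))).

End ColouredMultigraph.

(* Main.v *)
Require Import Defs.
From mathcomp Require Import all_boot.
From mathcomp Require Import zify.
Set Implicit Arguments. Unset Strict Implicit. Unset Printing Implicit Defensive.

(** Keep exactly [n] colours and let [k W] be the number of colours with an edge inside [W].  If
    [0 < #|W| <= k W] then [W] contains a rainbow cycle of length at most [#|W|], so we may assume
    that such sets have at least [g] vertices, where [g] exceeds [(4n + 63) / 9].  A breadth-first
    search from a vertex of degree three then shows that [k W > #|W|] forces [2 #|W| + 4 >= 3 g].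

    If every vertex [v] is the centre of a star colour, the leaves of these stars form a digraph of
    out-degree at least three in which directed cycles are rainbow.  Counting breadth-first layers,
    a layer of size at most two costs [g] vertices and a layer of size one costs [2 g - 2], which
    gives [3 n + 7 >= 7 g].

    Otherwise some vertex [x] is the centre of no colour, so [k (V \ x) = n > #|V \ x|]; averaging
    over such vertices, all but three colours have two edges avoiding [x].  Take a minimal [W]
    avoiding [x] with [k W > #|W|].  By minimality all but two colours have at most one edge inside
    [W], so all but five colours have an edge avoiding [x] with at most one end in [W].  Hence about
    [#|V \ W|] vertices of [W] suffice to extend [V \ W \ x] to a set [W'] with [k W' > #|W'|].
    The degree-three bound for [W] and for [W'] gives [4 n + 50 >= 9 g]. *)

(** * Digraphs of minimum out-degree three *)

Lemma exists_min_card (T : finType) (P : pred {set T}) (A0 : {set T}) :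
  P A0 -> exists2 A, P A & forall B, P B -> #|A| <= #|B|.
Proof.
by move=> PA0; case: (arg_minnP (fun A : {set T} => #|A|) PA0) => A PA minA; exists A.
Qed.

(** * Balls and boundaries in a digraph *)

Section Balls.
Variables (V : finType) (out : V -> {set V}).

Definition boundary (U : {set V}) : {set V} := \bigcup_(v in U) out v :\: U.

Fixpoint ball (k : nat) (v : V) : {set V} :=
  if k is k'.+1 then ball k' v :|: \bigcup_(u in ball k' v) out u else [set v].

Definition closed_set (S : {set V}) := [forall v in S, out v \subset S].

Lemma ballS k v : ball k.+1 v = ball k v :|: boundary (ball k v).
Proof.
by apply/setP => w; rewrite /= /boundary !inE; case: (_ \in ball _ _).
Qed.

Lemma disjoint_boundary (U : {set V}) : [disjoint U & boundary U].
Proof. by rewrite disjoint_sym disjoints_subset /boundary setDE subsetIr. Qed.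

Lemma card_ballS k v : #|ball k.+1 v| = #|ball k v| + #|boundary (ball k v)|.
Proof. by rewrite ballS cardsU disjoint_setI0 ?disjoint_boundary // cards0 subn0. Qed.

Lemma ball_center k v : v \in ball k v.
Proof. by elim: k => [|k IH] /=; rewrite ?inE // IH. Qed.

Lemma boundaryP (U : {set V}) v w : v \in U -> w \in out v -> w \in U :|: boundary U.
Proof.
move=> vU wv; rewrite !inE; case: (boolP (w \in U)) => //= _.
by apply/bigcupP; exists v.
Qed.

Lemma boundary_eq0 (U : {set V}) : (boundary U == set0) = closed_set U.
Proof.
rewrite /boundary setD_eq0; apply/bigcupsP/forall_inP; exact.
Qed.

Lemma ball_sub k v (S : {set V}) : closed_set S -> v \in S -> ball k v \subset S.
Proof.
move=> /forall_inP cS vS; elim: k => [|k IH]; first by rewrite sub1set.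
rewrite /= subUset IH; apply/bigcupsP => u uB.
by apply: cS; apply: (subsetP IH).
Qed.

Lemma ball_mono j k v : j <= k -> ball j v \subset ball k v.
Proof.
move=> /subnK <-; elim: (k - j) => [|i IH] //.
by apply: subset_trans IH _; rewrite addSn ballS subsetUl.
Qed.

Lemma ball_stable v : exists k, closed_set (ball k v).
Proof.
have [|nex] := boolP [exists k : 'I_(#|V|.+1), closed_set (ball k v)].
  by case/existsP=> k ck; exists k.
suff H k : k <= #|V|.+1 -> k.+1 <= #|ball k v|.
  by have := H _ (leqnn _); rewrite leqNgt ltnS (leq_trans (max_card _)).
elim: k => [_|k IH lekV]; first by rewrite cards1.
rewrite card_ballS.
have : ~~ closed_set (ball k v).
  by rewrite negb_exists in nex; apply: (forallP nex (Ordinal lekV)).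
rewrite -boundary_eq0 -card_gt0 => bd0.
by have := IH (ltnW lekV); lia.
Qed.

Lemma card_ball_growth (b j : nat) v :
  (forall k, k < j -> b <= #|boundary (ball k v)|) -> 1 + b * j <= #|ball j v|.
Proof.
elim: j => [_|j IH H]; first by rewrite cards1 muln0.
rewrite card_ballS; have := H j (ltnSn j).
have := IH (fun k kj => H k (ltnW kj)); lia.
Qed.

Lemma card_ball_growth_from (b i j : nat) v : i <= j ->
  (forall k, k < j -> b <= #|boundary (ball k v)|) ->
  #|ball i v| + b * (j - i) <= #|ball j v|.
Proof.
elim: j => [|j IH] lij H.
  by move: lij; rewrite leqn0 => /eqP ->; rewrite subnn muln0 addn0.
move: lij; rewrite leq_eqVlt => /orP[/eqP-> |lij].
  by rewrite subnn muln0 addn0.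
rewrite card_ballS; have := H j (ltnSn j).
have := IH lij (fun k kj => H k (ltnW kj)); rewrite subSn //; lia.
Qed.

End Balls.

(** * Girth of digraphs and sizes of breadth-first layers *)

Section Digraph.
Variables (V : finType) (g : nat).

(* For a digraph this says exactly that every directed cycle has length at least [g]. *)
Definition girth_ge (out : V -> {set V}) :=
  forall W : {set V}, W != set0 ->
    (forall v, v \in W -> out v :&: W != set0) -> g <= #|W|.

Lemma girth_ge_sub (out out' : V -> {set V}) :
  (forall v, out' v \subset out v) -> girth_ge out -> girth_ge out'.
Proof.
move=> sub gir W W0 H; apply: gir => // v /H /set0Pn[w].
rewrite inE => /andP[wv wW]; apply/set0Pn; exists w.
by rewrite inE wW (subsetP (sub v)).
Qed.

Variable out : V -> {set V}.
Local Notation bd := (boundary out).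
Local Notation ball := (ball out).

(** [P] collects the vertices of a walk from [v] to [w] that are followed by a further step, so each
    has its successor in [w |: P]. Girth is stated for vertex sets, hence this form. *)
Lemma ball_walk k v w : w \in ball k v ->
  exists P : {set V}, [/\ #|P| <= k, v \in w |: P &
    forall p, p \in P -> out p :&: (w |: P) != set0].
Proof.
elim: k w => [|k IH] w /=.
  rewrite inE => /eqP->; exists set0; split; rewrite ?cards0 ?inE ?eqxx //.
  by move=> p; rewrite inE.
rewrite inE => /orP[/IH[P [cP vP hP]]|/bigcupP[a /IH[P [cP vP hP]] wa]].
  by exists P; split=> //; lia.
exists (a |: P); split.
- by rewrite cardsU1; case: (_ \notin _); lia.
- by rewrite inE vP orbT.
- move=> p; rewrite !inE => /orP[/eqP->|pP].
    by apply/set0Pn; exists w; rewrite !inE wa eqxx.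
  have /set0Pn[y] := hP _ pP; rewrite !inE => /andP[yp yaP].
  by apply/set0Pn; exists y; rewrite !inE yp yaP orbT.
Qed.

(** Two walks joined end to end: as [u != t], the end of each lies in the set of the other, so every
    vertex of [P :|: Q] has a successor there. *)
Lemma closed_walk_length (u t : V) d m : girth_ge out -> u != t ->
  t \in ball d u -> u \in ball m t -> g <= d + m.
Proof.
move=> gir ut /ball_walk[P [cP uP hP]] /ball_walk[Q [cQ tQ hQ]].
have uP' : u \in P by move: uP; rewrite !inE (negPf ut).
have tQ' : t \in Q by move: tQ; rewrite !inE eq_sym (negPf ut).
apply: leq_trans (gir (P :|: Q) _ _) _.
- by apply/set0Pn; exists u; rewrite inE uP'.
- move=> v; rewrite inE => /orP[/hP|/hQ] /set0Pn[y];
    rewrite !inE => /andP[yv yPQ]; apply/set0Pn; exists y; rewrite !inE yv /=;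
    by case/orP: yPQ => [/eqP->|->]; rewrite ?uP' ?tQ' ?orbT.
- by apply: leq_trans (leq_card_setU _ _) _; lia.
Qed.

Lemma closing_arc_length (v w : V) k : girth_ge out ->
  w \in ball k v -> v \in out w -> g <= k.+1.
Proof.
move=> gir /ball_walk[P [cP vP hP]] vw.
apply: leq_trans (gir (w |: P) _ _) _.
- by apply/set0Pn; exists w; rewrite !inE eqxx.
- move=> p; rewrite inE => /orP[|/hP //]; rewrite inE => /eqP->.
  by apply/set0Pn; exists v; rewrite inE vw vP.
- by rewrite cardsU1; case: (_ \notin _); lia.
Qed.

Lemma girth_small_boundary (U : {set V}) b : girth_ge out -> U != set0 ->
  #|bd U| <= b -> (forall v, v \in U -> b < #|out v|) -> g <= #|U|.
Proof.
move=> gir U0 cbd deg; apply: gir => // v vU.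
apply/eqP => E; have := deg v vU; rewrite ltnNge => /negP; apply.
apply: leq_trans cbd; apply/subset_leq_card/subsetP => w wv.
have := boundaryP vU wv; rewrite inE => /orP[wU|//].
by move: (in_set0 w); rewrite -E inE wv wU.
Qed.

Definition long_ball (S : {set V}) v :=
  v \in S /\ (forall k, k.+2 <= g -> 2 <= #|bd (ball k v)|).

(** [t] stands for the only exit of [U], [u] for a vertex of [U] nearest to [t] along walks from
    [t], [d] for the distance from [u] to [t] and [m] for that from [t] to [u]. The fields keep what
    the counting uses. *)
Record bottleneck (S U : {set V}) (t u : V) (d m : nat) : Prop := Bottleneck {
  bn_sub : U \subset S; bn_bd : #|bd U| <= 1; bn_t : t \in S; bn_u : u \in U;
  bn_d : 0 < d; bn_m : 0 < m; bn_len : g <= d + m;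
  bn_in : ball d.-1 u \subset U;
  bn_grow : forall k, k.+2 <= d -> 2 <= #|bd (ball k u)|;
  bn_disj : [disjoint ball m.-1 t & U] }.

(** In a minimal nonempty closed set [A] every ball grows until it equals [A]. If no subset of [A]
    has a boundary of size one, layers have size at least two until then; otherwise a smallest such
    subset is a bottleneck. *)
Lemma long_ball_or_bottleneck (S : {set V}) : girth_ge out ->
  S != set0 -> closed_set out S -> (forall v, v \in S -> out v != set0) ->
  (exists v, long_ball S v) \/ (exists U t u d m, bottleneck S U t u d m).
Proof.
move=> gir S0 cS o0.
pose P (A : {set V}) := [&& A != set0, A \subset S & closed_set out A].
have [|A /and3P[A0 AS cA] minA] := @exists_min_card _ P S.
  by rewrite /P S0 cS subxx.
have clA (B : {set V}) : B != set0 -> B \subset A -> closed_set out B -> B = A.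
  move=> B0 BA cB; apply/eqP; rewrite eqEcard BA minA // /P B0 cB.
  by rewrite (subset_trans BA AS).
have ball_top v : v \in A -> exists k, ball k v = A.
  move=> vA; have [k ck] := ball_stable out v; exists k; apply: clA => //.
    by apply/set0Pn; exists v; apply: ball_center.
  exact: ball_sub.
pose Q (U : {set V}) := [&& U != set0, U \subset A & #|bd U| == 1].
have [/existsP[U1 QU1]|] := boolP [exists U, Q U]; last first.
  rewrite negb_exists => /forallP nQ; left.
  have [v vA] := set0Pn _ A0; exists v; split; first exact: (subsetP AS).
  move=> k kg.
  have BA : ball k v \subset A by apply: ball_sub.
  have B0 : ball k v != set0 by apply/set0Pn; exists v; apply: ball_center.
  (* Otherwise [A :\ v] would be closed, against minimality, or empty, against [o0]. The arc from
     [w] to [v] keeps a ball of small radius from being all of [A]. *)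
  have [w wA vw] : exists2 w, w \in A & v \in out w.
    apply/exists_inP; apply: contraT; rewrite negb_exists_in => /forall_inP nv.
    have : closed_set out (A :\ v).
      apply/forall_inP => w /setD1P[_ wA]; apply/subsetP => y yw.
      rewrite !inE (subsetP (forall_inP cA w wA)) // andbT.
      by apply/eqP => yv; move: (nv w wA); rewrite -yv yw.
    have [E _|ne] := eqVneq (A :\ v) set0; last first.
      move/(clA _ ne (subD1set _ _)) => E; move: vA.
      by rewrite -E !inE eqxx.
    have /set0Pn[y yv] := o0 v (subsetP AS v vA).
    have yA := subsetP (forall_inP cA v vA) y yv.
    have [yv0|yv0] := eqVneq y v; first by move: (nv v vA); rewrite -{1}yv0 yv.
    have : y \in set0 by rewrite -E !inE yv0.
    by rewrite inE.
  have nB : ball k v != A.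
    apply/eqP => E; have := @closing_arc_length v w k gir; rewrite E => /(_ wA vw).
    by rewrite leqNgt kg.
  have := nQ (ball k v); rewrite /Q B0 BA /= => n1.
  have : bd (ball k v) != set0.
    by rewrite boundary_eq0; apply: contra nB => /(clA _ B0 BA) ->.
  by rewrite -card_gt0; case: #|_| n1 => [|[|]].
right.
have [|U /and3P[U0 UA /cards1P[t bdU]] minU] := @exists_min_card _ Q U1; first by [].
have tnU : t \notin U.
  by have : t \in bd U by [rewrite bdU inE]; rewrite !inE => /andP[].
have tA : t \in A.
  have : t \in bd U by rewrite bdU inE.
  rewrite inE => /andP[_ /bigcupP[v vU tv]].
  by apply: (subsetP (forall_inP cA v (subsetP UA v vU))).
have [m0 Em0] := ball_top t tA.
have [w0 w0U] := set0Pn _ U0.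
have exm : exists m, ball m t :&: U != set0.
  by exists m0; apply/set0Pn; exists w0; rewrite inE Em0 w0U (subsetP UA).
case: (ex_minnP exm) => m /set0Pn[u]; rewrite inE => /andP[um uU] minm.
have uA := subsetP UA u uU.
have [d0 Ed0] := ball_top u uA.
have exd : exists d, t \in ball d u by exists d0; rewrite Ed0.
case: (ex_minnP exd) => d td mind.
have ut : u != t by apply: contraNneq tnU => <-.
have d0' : 0 < d.
  by case: d td {mind} => //; rewrite inE eq_sym (negPf ut).
have m0' : 0 < m.
  by case: m um {minm} => //; rewrite inE (negPf ut).
have inU k : k < d -> ball k u \subset U.
  elim: k => [|k IH] kd; first by rewrite sub1set.
  have BU := IH (ltnW kd); apply/subsetP => w wB.
  have : w \in U :|: bd U.
    move: wB; rewrite /= inE => /orP[/(subsetP BU) wU|/bigcupP[a aB wa]].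
      by rewrite inE wU.
    exact: boundaryP (subsetP BU a aB) wa.
  rewrite bdU !inE => /orP[//|/eqP wt].
  by have := mind k.+1; rewrite -wt wB => /(_ isT); rewrite leqNgt kd.
exists U, t, u, d, m; split=> //.
- exact: subset_trans AS.
- by rewrite bdU cards1.
- exact: (subsetP AS).
- exact: closed_walk_length gir ut td um.
- by apply: inU; rewrite prednK.
(* An empty boundary would make the ball equal to [A], which contains [t]. A boundary of size one
   would make it equal to [U] by minimality, but its boundary lies in [U]. *)
- move=> k kd; have kU := inU k (ltnW kd).
  have bU : bd (ball k u) \subset U.
    by apply: subset_trans (inU k.+1 kd); rewrite ballS subsetUr.
  have k0 : ball k u != set0 by apply/set0Pn; exists u; apply: ball_center.
  case E: #|bd (ball k u)| => [|[|//]].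
    move/eqP: E; rewrite cards_eq0 boundary_eq0.
    move/(clA _ k0 (subset_trans kU UA)) => E.
    by move: tA; rewrite -E => /(subsetP kU); rewrite (negPf tnU).
  have /minU leU : Q (ball k u) by rewrite /Q k0 (subset_trans kU UA) E.
  have EU : ball k u = U by apply/eqP; rewrite eqEcard kU.
  move: bU; rewrite EU bdU sub1set; exact: contraLR.
- by rewrite -setI_eq0; apply: contraT => /minm; rewrite -{1}(prednK m0') ltnn.
Qed.

(** The ball of radius [m - 1] about [t] lies outside [U]: either all its layers have size at least
    two, or one of the smaller balls serves as [Y]. *)
Lemma bottleneck_outside (S U : {set V}) t u d m : closed_set out S ->
  bottleneck S U t u d m ->
  #|U| + 2 * m <= #|S| + 1 \/
  exists Y : {set V}, [/\ Y != set0, Y \subset S, #|bd Y| <= 1 & #|U| + #|Y| <= #|S|].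
Proof.
move=> cS bn.
have card2 k : k <= m.-1 -> #|U| + #|ball k t| <= #|S|.
  move=> km; have dYU : [disjoint U & ball k t].
    by rewrite disjoint_sym (disjointWl (ball_mono out t km) (bn_disj bn)).
  rewrite -[_ + _]subn0 -(cards0 V) -(disjoint_setI0 dYU) -cardsU.
  by apply: subset_leq_card; rewrite subUset (bn_sub bn) ball_sub ?(bn_t bn).
have [/existsP[k bk]|nk] := boolP [exists k : 'I_m.-1, #|bd (ball k t)| <= 1].
  right; exists (ball k t); split=> //.
  - by apply/set0Pn; exists t; apply: ball_center.
  - by rewrite ball_sub ?(bn_t bn).
  - by apply: card2; apply: ltnW.
left; have grow k : k < m.-1 -> 2 <= #|bd (ball k t)|.
  by move=> km; move: nk; rewrite negb_exists => /forallP/(_ (Ordinal km)); rewrite -ltnNge.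
by have := card_ball_growth grow; have := card2 _ (leqnn _); have := bn_m bn; lia.
Qed.

(** A long ball has at least [1 + 2 * (g - 1)] vertices. At a bottleneck, either [U] and [Y] have at
    least [g] vertices each, or the layers about [u] and [t] together give [2 * (d + m) - 2]. *)
Lemma card_outdeg2 (S : {set V}) : girth_ge out -> S != set0 -> closed_set out S ->
  (forall v, v \in S -> 2 <= #|out v|) -> 2 * g <= #|S| + 2.
Proof.
move=> gir S0 cS deg.
have o0 v : v \in S -> out v != set0 by move/deg; rewrite -card_gt0; apply: ltnW.
case: (long_ball_or_bottleneck gir S0 cS o0) => [[v [vS grow]]|[U [t [u [d [m bn]]]]]].
  have le1 := subset_leq_card (ball_sub g.-1 cS vS).
  have : 1 + 2 * g.-1 <= #|ball g.-1 v|.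
    by apply: card_ball_growth => k kg; apply: grow; lia.
  lia.
have gS (Y : {set V}) : Y != set0 -> Y \subset S -> #|bd Y| <= 1 -> g <= #|Y|.
  by move=> Y0 YS bY; apply: girth_small_boundary bY _ => // v /(subsetP YS)/deg.
have U0 : U != set0 by apply/set0Pn; exists u; apply: (bn_u bn).
case: (bottleneck_outside cS bn) => [le1|[Y [Y0 YS bY le1]]]; last first.
  have := gS _ Y0 YS bY; have := gS _ U0 (bn_sub bn) (bn_bd bn); lia.
have le2 := subset_leq_card (bn_in bn).
have : 1 + 2 * d.-1 <= #|ball d.-1 u|.
  by apply: card_ball_growth => k kg; apply: (bn_grow bn); lia.
by have := bn_d bn; have := bn_len bn; lia.
Qed.

(* A boundary of size two makes the ball contain a cycle, so narrow layers are paid for by [g]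
   vertices at the first of them; the bound interpolates between the two estimates there. *)
Lemma card_ball_outdeg3 (S : {set V}) v j : girth_ge out -> closed_set out S -> v \in S ->
  (forall v, v \in S -> 3 <= #|out v|) ->
  (forall k, k < j -> 2 <= #|bd (ball k v)|) ->
  g + 2 + 6 * j <= 3 * #|ball j v| \/ 1 + 3 * j <= #|ball j v|.
Proof.
move=> gir cS vS deg grow.
have [/existsP[i0 bi0]|nk] := boolP [exists k : 'I_j, #|bd (ball k v)| <= 2]; last first.
  right; apply: card_ball_growth => k kj.
  by move: nk; rewrite negb_exists => /forallP/(_ (Ordinal kj)); rewrite -ltnNge.
have exi : exists i, (i < j) && (#|bd (ball i v)| <= 2) by exists i0; rewrite ltn_ord bi0.
case: (ex_minnP exi) => i /andP[ij bi] mini; left.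
have c1 : 1 + 3 * i <= #|ball i v|.
  apply: card_ball_growth => k ki; rewrite ltnNge; apply/negP => bk.
  by have := mini k; rewrite bk (ltn_trans ki ij) => /(_ isT); lia.
have c2 : g <= #|ball i v|.
  apply: girth_small_boundary bi _ => //.
    by apply/set0Pn; exists v; apply: ball_center.
  by move=> w /(subsetP (ball_sub i cS vS))/deg.
have := card_ball_growth_from (ltnW ij) grow; lia.
Qed.

Lemma girth_ge_inter (U : {set V}) :
  girth_ge out -> girth_ge (fun v => out v :&: U).
Proof. by apply: girth_ge_sub => v; apply: subsetIl. Qed.
End Digraph.

(** Inside [U] each vertex loses at most one out-neighbour, so the out-degree-two bound applies to
    the digraph induced on [U]. *)
Lemma card_boundary1 (V : finType) (g : nat) (out : V -> {set V}) (U : {set V}) :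
  girth_ge g out -> U != set0 -> #|boundary out U| <= 1 ->
  (forall v, v \in U -> 3 <= #|out v|) -> 2 * g <= #|U| + 2.
Proof.
move=> gir U0 bU deg; refine (card_outdeg2 (girth_ge_inter (U := U) gir) U0 _ _).
  by apply/forall_inP => v _; apply: subsetIr.
move=> v vU; have := deg v vU; rewrite -(cardsID U (out v)).
suff : #|out v :\: U| <= 1 by lia.
apply: leq_trans bU; apply/subset_leq_card/subsetP => w; rewrite !inE => /andP[wU wv].
by rewrite wU; apply/bigcupP; exists v.
Qed.

Theorem card_outdeg3 (V : finType) (g : nat) (out : V -> {set V}) (S : {set V}) :
  girth_ge g out -> S != set0 -> closed_set out S ->
  (forall v, v \in S -> 3 <= #|out v|) -> 7 * g <= 3 * #|S| + 7.
Proof.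
move=> gir S0 cS deg.
have o0 v : v \in S -> out v != set0.
  by move/deg; rewrite -card_gt0; apply: leq_trans.
case: (long_ball_or_bottleneck gir S0 cS o0) => [[v [vS grow]]|[U [t [u [d [m bn]]]]]].
  have le1 := subset_leq_card (ball_sub g.-1 cS vS).
  have [] := @card_ball_outdeg3 _ g out S v g.-1 gir cS vS deg; try lia.
  by move=> k kg; apply: grow; lia.
have gS (Y : {set V}) : Y != set0 -> Y \subset S -> #|boundary out Y| <= 1 -> 2 * g <= #|Y| + 2.
  by move=> Y0 YS bY; apply: card_boundary1 gir Y0 bY _ => v /(subsetP YS)/deg.
have U0 : U != set0 by apply/set0Pn; exists u; apply: (bn_u bn).
have gU := gS _ U0 (bn_sub bn) (bn_bd bn).
case: (bottleneck_outside cS bn) => [le1|[Y [Y0 YS bY le1]]]; last first.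
  have := gS _ Y0 YS bY; lia.
have le2 := subset_leq_card (bn_in bn).
have uS : u \in S := subsetP (bn_sub bn) u (bn_u bn).
(* The first ball bound gives [3 * #|U| >= g + 6 * d - 4], which suffices with [le1] and
   [d + m >= g]. The second bound is combined with [gU]. *)
have := bn_d bn; have := bn_m bn; have := bn_len bn.
have [] := @card_ball_outdeg3 _ g out S u d.-1 gir cS uS deg; try lia.
by move=> k kg; apply: (bn_grow bn); lia.
Qed.

(** * Graphs with more edges than vertices *)

Section SparseGraph.
Variables (V : finType) (g : nat) (F : {set {set V}}).

Definition edges_in (Q : {set V}) : {set {set V}} := [set f in F | f \subset Q].

Definition n_edges (Q : {set V}) : nat := #|edges_in Q|.

Definition sparse :=
  forall Q : {set V}, Q != set0 -> #|Q| <= n_edges Q -> g <= #|Q|.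

Hypothesis F2 : forall f, f \in F -> #|f| = 2.
Hypothesis spF : sparse.

(** The number of spanned edges is supermodular, and a nonempty intersection below [g] spans fewer
    edges than vertices. The condition [#|P| <= (n_edges P).+1] stands in for connectedness. *)
Lemma card_edges_inU (P P' : {set V}) : P :&: P' != set0 -> #|P :&: P'| < g ->
  #|P| <= (n_edges P).+1 -> #|P'| <= (n_edges P').+1 ->
  #|P :|: P'| <= (n_edges (P :|: P')).+1.
Proof.
move=> PP0 lt tP tP'.
have h1 : n_edges (P :&: P') < #|P :&: P'|.
  by rewrite ltnNge; apply: contraL lt => /(spF PP0); rewrite -leqNgt.
have sub : edges_in P :|: edges_in P' \subset edges_in (P :|: P').
  apply/subsetP => f; rewrite !inE => /orP[] /andP[-> /subset_trans]; apply.
    exact: subsetUl.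
  exact: subsetUr.
have eqI : edges_in P :&: edges_in P' = edges_in (P :&: P').
  by apply/setP => f; rewrite !inE subsetI; case: (_ \in F).
have := subset_leq_card sub; have := cardsUI (edges_in P) (edges_in P').
rewrite eqI -!/(n_edges _); by have := cardsUI P P'; move: h1 tP tP'; clear; lia.
Qed.

Lemma card_edges_in_addvertex (P N : {set V}) w : w \notin P -> N \subset P ->
  (forall a, a \in N -> [set a; w] \in F) ->
  n_edges P + #|N| <= n_edges (w |: P).
Proof.
move=> wP NP hN.
have inj : {in N &, injective (fun a => [set a; w])}.
  move=> a b aN bN /setP/(_ a); rewrite !inE eqxx /= => /esym/orP[/eqP//|/eqP aw].
  by move: wP; rewrite -aw (subsetP NP).
rewrite -(card_in_imset inj) -[_ + _]subn0 /n_edges.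
have <- : #|edges_in P :&: [set [set a; w] | a in N]| = 0.
  apply/eqP; rewrite cards_eq0 -subset0; apply/subsetP => f.
  rewrite inE => /andP[]; rewrite inE => /andP[_ fP] /imsetP[a _ fE].
  by move: wP; rewrite (subsetP fP) // fE !inE eqxx orbT.
rewrite -cardsU; apply: subset_leq_card; rewrite subUset; apply/andP; split.
  apply/subsetP => f; rewrite !inE => /andP[-> /subset_trans]; apply.
  exact: subsetUr.
apply/subsetP => f /imsetP[a aN ->]; rewrite inE hN //=.
by apply/subsetP => y; rewrite !inE => /orP[] /eqP->; rewrite ?eqxx // (subsetP NP) ?orbT.
Qed.

(** * Breadth-first search in a sparse graph *)

Variable Q : {set V}.
Definition nbrs (v : V) : {set V} := [set u | [set v; u] \in edges_in Q & u != v].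

Lemma nbrs_sym u v : (u \in nbrs v) = (v \in nbrs u).
Proof. by rewrite !inE setUC eq_sym. Qed.

Lemma nbrs_edge u v : u \in nbrs v -> [set v; u] \in F.
Proof. by rewrite !inE => /andP[/andP[]]. Qed.

Lemma nbrs_sub v : nbrs v \subset Q.
Proof.
apply/subsetP => u; rewrite !inE => /andP[/andP[_ /subsetP s] _]; apply: s.
by rewrite !inE eqxx orbT.
Qed.

Lemma card_nbrs v : #|[set f in edges_in Q | v \in f]| <= #|nbrs v|.
Proof.
apply: leq_trans (leq_imset_card (fun u => [set v; u]) (nbrs v)).
apply/subset_leq_card/subsetP => f; rewrite inE => /andP[fE vf].
have /F2 : f \in F by move: fE; rewrite inE => /andP[].
rewrite (cardsD1 v) vf => -[] /eqP/cards1P[u Eu].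
have ufv : u \in f :\ v by rewrite Eu inE.
have fE' : f = [set v; u] by rewrite -(setD1K vf) Eu.
apply/imsetP; exists u => //; rewrite inE -fE' fE.
by case/setD1P: ufv.
Qed.

Local Notation ball := (ball nbrs).

(** [P] is the vertex set of a path from [v] to [w]. *)
Lemma ball_tree k v w : w \in ball k v -> exists P : {set V},
  [/\ v \in P, w \in P, P \subset ball k v, #|P| <= k.+1 & #|P| <= (n_edges P).+1].
Proof.
elim: k w => [|k IH] w.
  rewrite inE => /eqP->; exists [set v]; split; rewrite ?inE ?cards1 ?subxx //.
have [wB _|wB] := boolP (w \in ball k v).
  have [P [vP wP sP cP tP]] := IH w wB; exists P; split=> //; last exact: leqW.
  by apply: subset_trans sP (ball_mono _ _ (leqnSn k)).
rewrite /= inE (negPf wB) => /bigcupP[a /IH[P [vP aP sP cP tP]] wa].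
have wP : w \notin P by apply: contra wB; apply: (subsetP sP).
exists (w |: P); split; rewrite ?inE ?eqxx ?vP ?orbT //.
- rewrite subUset sub1set; apply/andP; split; last exact: subset_trans sP (subsetUl _ _).
  by rewrite inE; apply/orP; right; apply/bigcupP; exists a => //; move: aP; apply: (subsetP sP).
- by rewrite cardsU1 wP.
- have : n_edges P + #|[set a]| <= n_edges (w |: P).
    apply: card_edges_in_addvertex => //; first by rewrite sub1set.
    by move=> b; rewrite inE => /eqP->; apply: nbrs_edge.
  by rewrite cards1 [#|w |: P|]cardsU1 wP; move: tP; clear; lia.
Qed.

Lemma ball_tree2 k v a b : a \in ball k v -> b \in ball k v ->
  g <= k.+1 \/ exists P : {set V},
  [/\ a \in P, b \in P, P \subset ball k v, #|P| <= (2 * k).+1 & #|P| <= (n_edges P).+1].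
Proof.
move=> /ball_tree[P [vP aP sP cP tP]] /ball_tree[P' [vP' bP' sP' cP' tP']].
have vI : v \in P :&: P' by rewrite inE vP.
have [le|lt] := leqP g #|P :&: P'|.
  by left; apply: leq_trans le (leq_trans _ cP); apply/subset_leq_card/subsetIl.
right; exists (P :|: P'); rewrite !inE aP bP' orbT subUset sP sP'; split=> //.
  have := cardsUI P P'.
  have : 0 < #|P :&: P'| by apply/card_gt0P; exists v.
  by move: cP cP'; clear; lia.
by apply: card_edges_inU => //; apply/set0Pn; exists v.
Qed.

(** A set joining [a] and [b] lacks at most one edge; adding [u] brings one vertex and two edges, so
    [sparse] applies to at most [2 * k + 2] vertices. *)
Lemma two_parents k v u a b : u \notin ball k v -> a \in ball k v -> b \in ball k v ->
  u \in nbrs a -> u \in nbrs b -> a != b -> g <= 2 * k + 2.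
Proof.
move=> uB aB bB ua ub ab.
case: (ball_tree2 aB bB) => [|[P [aP bP sP cP tP]]]; first by clear; lia.
have uP : u \notin P by apply: contra uB; apply: (subsetP sP).
have h : n_edges P + #|[set a; b]| <= n_edges (u |: P).
  apply: card_edges_in_addvertex => //.
    by apply/subsetP => y; rewrite !inE => /orP[] /eqP->.
  by move=> y; rewrite !inE => /orP[] /eqP->; apply: nbrs_edge.
have cu : #|u |: P| = #|P|.+1 by rewrite cardsU1 uP.
have := @spF (u |: P); rewrite cu.
have -> : u |: P != set0 by apply/set0Pn; exists u; rewrite !inE eqxx.
move/(_ isT); rewrite cards2 ab in h; move: h cP tP; clear; lia.
Qed.

(** As with two parents, but [u] and [u'] bring two vertices and three edges. *)
Lemma adjacent_in_layer k v u u' a a' : u \notin ball k v -> u' \notin ball k v ->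
  a \in ball k v -> a' \in ball k v ->
  u \in nbrs a -> u' \in nbrs a' -> u' \in nbrs u -> g <= 2 * k + 3.
Proof.
move=> uB uB' aB aB' ua ua' uu.
case: (ball_tree2 aB aB') => [|[P [aP aP' sP cP tP]]]; first by clear; lia.
have uP : u \notin P by apply: contra uB; apply: (subsetP sP).
have neq : u' != u by move: uu; rewrite inE => /andP[].
have uP' : u' \notin u |: P.
  by rewrite !inE (negPf neq); apply: contra uB'; apply: (subsetP sP).
have h : n_edges P + #|[set a]| <= n_edges (u |: P).
  apply: card_edges_in_addvertex => //; first by rewrite sub1set.
  by move=> y; rewrite !inE => /eqP->; apply: nbrs_edge.
have h' : n_edges (u |: P) + #|[set a'; u]| <= n_edges (u' |: (u |: P)).
  apply: card_edges_in_addvertex => //.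
    by apply/subsetP => y; rewrite !inE => /orP[] /eqP->; rewrite ?eqxx // aP' orbT.
  by move=> y; rewrite !inE => /orP[] /eqP->; apply: nbrs_edge.
have au : a' != u by apply: contraNneq uB => <-.
have cu : #|u' |: (u |: P)| = #|P|.+2 by rewrite cardsU1 uP' cardsU1 uP.
have := @spF (u' |: (u |: P)); rewrite cu.
have -> : u' |: (u |: P) != set0 by apply/set0Pn; exists u'; rewrite !inE eqxx.
move/(_ isT); rewrite cards2 au in h'; rewrite cards1 in h.
move: h h' cP tP; clear; lia.
Qed.

(** Within this radius every layer vertex has a neighbour in the next layer, and different vertices
    have different ones, so no layer is smaller than the one before it. *)
Lemma layer_grows v : v \in Q -> 3 <= #|nbrs v| -> (forall u, u \in Q -> 2 <= #|nbrs u|) ->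
  forall k, 2 * k + 2 < g -> 3 <= #|boundary nbrs (ball k v)|.
Proof.
move=> vQ dv dg; elim=> [|k IH] kg.
  apply: leq_trans dv _; apply/subset_leq_card/subsetP => u uv.
  rewrite !inE; apply/andP; split; first by move: uv; rewrite inE => /andP[].
  by apply/bigcupP; exists v => //; rewrite inE.
have {}IH := IH ltac:(move: kg; clear; lia).
apply: leq_trans IH _.
have ex u : u \in boundary nbrs (ball k v) -> exists w, w \in nbrs u :\: ball k.+1 v.
  move=> uB; apply/set0Pn; rewrite setD_eq0; apply/negP => sub.
  move: uB; rewrite inE => /andP[uB /bigcupP[a aB ua]].
  have uQ : u \in Q := subsetP (nbrs_sub a) u ua.
  have au : a \in nbrs u by rewrite nbrs_sym.
  (* The second neighbour [b] of [u] would be a second parent if it were in the old ball, and an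
     adjacent vertex if it were in the same layer. *)
  have := dg u uQ; rewrite (cardsD1 a) au ltnS => /card_gt0P[b].
  rewrite inE => /andP[ba bu].
  have := subsetP sub b bu; rewrite ballS inE => /orP[bB|].
    have ub : u \in nbrs b by rewrite nbrs_sym.
    have ab : a != b by move: ba; rewrite inE eq_sym.
    by have := two_parents uB aB bB ua ub ab; move: kg; clear; lia.
  rewrite inE => /andP[bB /bigcupP[a' aB' ba']].
  by have := adjacent_in_layer uB bB aB aB' ua ba' bu; move: kg; clear; lia.
pose h u := odflt u [pick w in nbrs u :\: ball k.+1 v].
have hP u : u \in boundary nbrs (ball k v) -> h u \in nbrs u :\: ball k.+1 v.
  by move=> /ex[w wP]; rewrite /h; case: pickP => [//|/(_ w)]; rewrite wP.
have bS u : u \in boundary nbrs (ball k v) -> u \in ball k.+1 v.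
  by move=> uB; rewrite ballS inE uB orbT.
have inj : {in boundary nbrs (ball k v) &, injective h}.
  move=> u u' uB uB' E; apply/eqP; apply: contraT => neq.
  have /setDP[h1 hB] := hP u uB; have /setDP[h2 _] := hP u' uB'; rewrite -E in h2.
  have := two_parents hB (bS u uB) (bS u' uB') h1 h2 neq; move: kg; clear; lia.
rewrite -(card_in_imset inj); apply/subset_leq_card/subsetP => w /imsetP[u uB ->].
have := hP u uB; rewrite inE => /andP[hB hu]; rewrite inE hB.
by apply/bigcupP; exists u; rewrite ?bS.
Qed.

End SparseGraph.

(** A smallest [Q] of positive excess has minimum degree two and average degree above two, hence a
    vertex of degree three. The layers about it, up to radius [(g - 1) / 2], are counted. *)
Lemma card_excess1 (V : finType) (g : nat) (F : {set {set V}}) (W : {set V}) :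
  (forall f, f \in F -> #|f| = 2) -> sparse g F ->
  #|W| < n_edges F W -> 3 * g <= 2 * #|W| + 4.
Proof.
move=> F2 spF exW.
pose P (A : {set V}) := (A \subset W) && (#|A| < n_edges F A).
have [|Q /andP[QW exQ] minQ] := @exists_min_card _ P W; first by rewrite /P subxx.
have deg2 v : v \in Q -> 2 <= #|nbrs F Q v|.
  move=> vQ; apply: leq_trans (card_nbrs F2 Q v).
  have le : n_edges F (Q :\ v) <= #|Q :\ v|.
    rewrite leqNgt; apply/negP => lt.
    have := minQ (Q :\ v); rewrite /P lt (subset_trans (subD1set _ _) QW) => /(_ isT).
    by rewrite [X in X <= _](cardsD1 v) vQ ltnn.
  have E : edges_in F Q :\: [set f in edges_in F Q | v \in f] = edges_in F (Q :\ v).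
    apply/setP => f; rewrite !inE subsetD1; case: (f \in F) => //=.
    by case: (f \subset Q); rewrite ?andbT.
  have := cardsID [set f in edges_in F Q | v \in f] (edges_in F Q).
  rewrite E (setIidPr _); last by apply/subsetP => f; rewrite inE => /andP[].
  by rewrite -!/(n_edges _ _); move: exQ le; rewrite [#|Q|](cardsD1 v) vQ; clear; lia.
have [v vQ deg3] : exists2 v, v \in Q & 3 <= #|nbrs F Q v|.
  apply/exists_inP; apply: contraT; rewrite negb_exists_in => /forall_inP le2.
  suff : 2 * n_edges F Q <= 2 * #|Q| by move: exQ; clear; lia.
  rewrite /n_edges [2 * #|Q|]mulnC -sum_nat_const mulnC -sum_nat_const.
  have -> : \sum_(f in edges_in F Q) 2 = \sum_(f in edges_in F Q) \sum_(v in Q) (v \in f).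
    apply: eq_bigr => f; rewrite inE => /andP[fF fQ]; rewrite -(F2 f fF).
    rewrite -sum1_card [RHS]big_mkcond [LHS]big_mkcond; apply: eq_bigr => y _.
    by have := subsetP fQ y; case: (y \in f); case: (y \in Q) => //= /(_ isT).
  rewrite exchange_big /=; apply: leq_sum => v vQ.
  rewrite -big_mkcondr /= sum1dep_card.
  have := le2 v vQ; rewrite -leqNgt; apply: leq_trans.
  by apply: leq_trans (card_nbrs F2 Q v); apply/eq_leq/eq_card => f; rewrite !inE.
have grow k : k < g.-1./2 -> 3 <= #|boundary (nbrs F Q) (ball (nbrs F Q) k v)|.
  by move=> kg; apply: (layer_grows spF) => //; move: kg; clear; lia.
have cQ : closed_set (nbrs F Q) Q by apply/forall_inP => u _; apply: nbrs_sub.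
have := subset_leq_card (ball_sub (g.-1./2) cQ vQ).
have := card_ball_growth grow; have := subset_leq_card QW; clear; lia.
Qed.

(** * Edge-coloured graphs *)

Lemma sum_card_exchange (I J : finType) (A : {set I}) (B : {set J}) (r : I -> J -> bool) :
  \sum_(i in A) #|[set j in B | r i j]| = \sum_(j in B) #|[set i in A | r i j]|.
Proof.
have E (K L : finType) (C : {set K}) (D : {set L}) (s : K -> L -> bool) :
  \sum_(i in C) #|[set j in D | s i j]| = \sum_(i in C) \sum_(j in D) s i j.
  apply: eq_bigr => i _; rewrite -sum1dep_card big_mkcondr /=.
  by apply: eq_bigr => j _; case: (s i j).
by rewrite E exchange_big -(E _ _ _ _ (fun j i => r i j)).
Qed.

(** With weight [nu a - 1] on each element, [A] must weigh at least as much as [W]. Elements outside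
    [A0] with [nu] at most one are dropped at once; the others weigh at least one each, and in a
    smallest choice dropping one more would leave too little, which bounds their number. *)
Lemma greedy_selection (T : finType) (nu : T -> nat) (A0 W : {set T}) : A0 \subset W ->
  exists A : {set T}, [/\ A0 \subset A, A \subset W,
    \sum_(a in W) nu a + #|A| <= \sum_(a in A) nu a + #|W| &
    #|A| <= #|A0| \/ #|A| + #|W| <= \sum_(a in W) nu a + 2 * #|A0|].
Proof.
move=> A0W.
have split_sum (B A : {set T}) : B \subset A ->
  \sum_(a in A) nu a = \sum_(a in B) nu a + \sum_(a in A :\: B) nu a.
  by move=> BA; rewrite (big_setID B) /= (setIidPr BA).
pose P (A : {set T}) := [&& A0 \subset A, A \subset A0 :|: [set a in W | 2 <= nu a] &
  \sum_(a in W) nu a + #|A| <= \sum_(a in A) nu a + #|W|].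
pose A1 := A0 :|: [set a in W | 2 <= nu a].
have A1W : A1 \subset W by rewrite subUset A0W; apply/subsetP => a; rewrite inE => /andP[].
have [|A /and3P[A0A AA1 sumA] minA] := @exists_min_card _ P A1.
  rewrite /P subsetUl subxx /= -/A1 (split_sum A1 W) // -addnA leq_add2l.
  have <- : #|W :\: A1| + #|A1| = #|W|.
    by rewrite -(cardsID A1 W) (setIidPr A1W) addnC.
  rewrite leq_add2r -sum1_card; apply: leq_sum => a.
  by rewrite !inE negb_or => /andP[/andP[_ /nandP[/negPf->|]] //]; rewrite -ltnNge.
exists A; split=> //; first exact: subset_trans A1W.
have [AA0|/subsetPn[a aA aA0]] := boolP (A \subset A0).
  by left; apply: subset_leq_card.
right.
have A0Aa : A0 \subset A :\ a by rewrite subsetD1 A0A.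
have nP : ~~ P (A :\ a).
  by apply/negP => /minA; rewrite (cardsD1 a A) aA ltnn.
have ge2 b : b \in A -> b \notin A0 -> 2 <= nu b.
  by move=> /(subsetP AA1); rewrite !inE => /orP[->|/andP[]].
move: nP; rewrite /P A0Aa (subset_trans (subD1set _ _) AA1) /= -ltnNge.
have : 2 * #|A :\ a :\: A0| <= \sum_(b in A :\ a :\: A0) nu b.
  rewrite mulnC -sum_nat_const; apply: leq_sum => b; rewrite !inE => /and3P[bA0 _ bA].
  exact: ge2.
have : #|A :\ a| = #|A0| + #|A :\ a :\: A0| by rewrite -(cardsID A0) (setIidPr A0Aa).
rewrite (split_sum A0 (A :\ a)) // (cardsD1 a A) aA.
by clear; lia.
Qed.

(** * Colours with an edge inside a vertex set *)

Section ColouredGraph.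
Variables (V E C : finType) (ve : E -> {set V}) (col : E -> C) (K : {set C}) (g : nat).

Local Notation cls := (colour_class col).
Definition cols (W : {set V}) : {set C} :=
  [set c in K | [exists e in cls c, ve e \subset W]].

Hypothesis g3 : 3 <= g.
Hypothesis ve2 : forall e, col e \in K -> #|ve e| = 2.
Hypothesis simple : forall e1 e2, col e1 = col e2 -> ve e1 = ve e2 -> e1 = e2.
Hypothesis cls3 : forall c, c \in K -> 3 <= #|cls c|.
(** What the absence of a rainbow cycle shorter than [g] provides, by [exists_rainbow_cycle]. *)
Hypothesis dense : forall W : {set V}, W != set0 -> #|W| <= #|cols W| -> g <= #|W|.

Lemma colsP (W : {set V}) c : reflect (exists2 e, col e = c & (c \in K) && (ve e \subset W)) (c \in cols W).
Proof.
rewrite inE; apply: (iffP andP) => [[cK /exists_inP[e]]|[e ec /andP[-> eW]]].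
  by rewrite inE => /eqP ec eW; exists e; rewrite ?cK.
by split=> //; apply/exists_inP; exists e; rewrite // inE ec.
Qed.

(** One edge per colour of [cols W] forms a sparse graph. Different colours give different pairs,
    since a pair carrying two colours would violate [dense]. *)
Lemma card_excess1_cols (W : {set V}) : #|W| < #|cols W| -> 3 * g <= 2 * #|W| + 4.
Proof.
move=> exW.
have [E0|[c0 c0W]] := set_0Vmem (cols W); first by rewrite E0 cards0 in exW.
have [e0 _ _] := colsP _ _ c0W.
pose eta c := odflt e0 [pick e in cls c | ve e \subset W].
have etaP c : c \in cols W -> [/\ col (eta c) = c, c \in K & ve (eta c) \subset W].
  case/colsP => e ec /andP[cK eW]; rewrite /eta; case: pickP => [e'|/(_ e)].
    by rewrite !inE => /andP[/eqP].
  by rewrite !inE ec eqxx eW.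
pose F := [set ve (eta c) | c in cols W].
have inj : {in cols W &, injective (fun c => ve (eta c))}.
  move=> c c' cW cW' Ev; apply/eqP; apply: contraT => neq.
  have [e1 k1 _] := etaP c cW; have [e2 k2 _] := etaP c' cW'.
  have c2 : #|ve (eta c)| = 2 by rewrite ve2 // e1.
  have := @dense (ve (eta c)); rewrite c2 -card_gt0 c2 => /(_ isT).
  suff : [set c; c'] \subset cols (ve (eta c)).
    move/subset_leq_card; rewrite cards2 neq => h /(_ h); move: g3; clear; lia.
  apply/subsetP => d; rewrite !inE => /orP[] /eqP->; rewrite ?k1 ?k2 /=;
    apply/exists_inP; [exists (eta c)|exists (eta c')];
    by rewrite ?inE ?e1 ?e2 ?eqxx // Ev.
have F2 f : f \in F -> #|f| = 2.
  by case/imsetP => c /etaP[ec cK _] ->; rewrite ve2 // ec.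
have FW : edges_in F W = F.
  apply/setP => f; rewrite inE; case: (boolP (f \in F)) => // /imsetP[c /etaP[_ _ s] ->].
  by rewrite s.
apply: (card_excess1 F2); last by rewrite /n_edges FW /F card_in_imset.
move=> Q Q0 leQ; apply: dense => //; apply: leq_trans leQ _; rewrite /n_edges.
have -> : edges_in F Q = [set ve (eta c) | c in [set c in cols W | ve (eta c) \subset Q]].
  apply/setP => f; rewrite inE; apply/andP/imsetP => [[/imsetP[c cW ->] s]|[c]].
    by exists c => //; rewrite inE cW.
  by rewrite inE => /andP[cW s ->]; split=> //; apply/imsetP; exists c.
apply: leq_trans (leq_imset_card _ _) _; apply/subset_leq_card/subsetP => c.
rewrite inE => /andP[/etaP[ec cK _] s]; apply/colsP; exists (eta c) => //.
by rewrite cK.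
Qed.

Lemma same_colour_two_common e1 e2 u v : col e1 \in K -> col e1 = col e2 -> u != v ->
  u \in ve e1 -> v \in ve e1 -> u \in ve e2 -> v \in ve e2 -> e1 = e2.
Proof.
move=> k1 ec uv u1 v1 u2 v2; apply: simple => //.
have k2 : col e2 \in K by rewrite -ec.
have sub e : col e \in K -> u \in ve e -> v \in ve e -> [set u; v] = ve e.
  move=> ke ue ve_; apply/eqP; rewrite eqEcard ve2 // cards2 uv andbT.
  by apply/subsetP => y; rewrite !inE => /orP[] /eqP->.
by rewrite -(sub e1) // (sub e2).
Qed.

(** * Star colours and their centres *)

Definition star c v := [forall e in cls c, v \in ve e].
Definition noncentres : {set V} := [set v | ~~ [exists c in K, star c v]].

Lemma star_unique c u v : c \in K -> star c u -> star c v -> u = v.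
Proof.
move=> cK /forall_inP su /forall_inP sv; apply/eqP; apply: contraT => uv.
have := cls3 cK; case/card_gt2P => e1 [e2 [e3 [[e1c e2c _] [ne _ _]]]].
have [E1 E2] : col e1 = c /\ col e2 = c by move: e1c e2c; rewrite !inE => /eqP-> /eqP->.
case/eqP: ne; apply: same_colour_two_common uv (su _ e1c) (sv _ e1c) (su _ e2c) (sv _ e2c).
  by rewrite E1.
by rewrite E1 E2.
Qed.


(** [c0] is a default that is not reached at a centre of a star colour. *)
Definition star_at (c0 : C) (v : V) : C := odflt c0 [pick c in K | star c v].

Lemma star_atP c0 v : v \notin noncentres -> star_at c0 v \in K /\ star (star_at c0 v) v.
Proof.
rewrite inE negbK => /exists_inP[c cK cv]; rewrite /star_at.
by case: pickP => [c' /andP[]|/(_ c)] //; rewrite cK cv.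
Qed.

Lemma star_at_inj c0 : {in [predC noncentres] &, injective (star_at c0)}.
Proof.
move=> u v /(star_atP c0)[uK su] /(star_atP c0)[_ sv] Euv.
by apply: star_unique uK su _; rewrite Euv.
Qed.

(** Arcs go from each vertex to the leaves of a star colour centred there. These colours are
    distinct, so a set whose vertices all have out-neighbours inside contains at least as many
    colours as vertices, and [dense] becomes the girth condition. *)
Lemma bound_all_centres (v0 : V) : noncentres = set0 -> 7 * g <= 3 * #|V| + 7.
Proof.
move=> Z0.
have nZ v : v \notin noncentres by rewrite Z0 inE.
have [c0 _ _] : exists2 c, c \in K & star c v0.
  by apply/exists_inP; move: (nZ v0); rewrite inE negbK.
pose tau := star_at c0.
have tauK v : tau v \in K by have [] := star_atP c0 (nZ v).
have tauS v e : col e = tau v -> v \in ve e.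
  by have [_ /forall_inP/(_ e)] := star_atP c0 (nZ v); rewrite inE => h /eqP.
pose out v := \bigcup_(e in cls (tau v)) ve e :\ v.
have := @card_outdeg3 V g out [set: V]; rewrite cardsT; apply.
- move=> W W0 hW; apply: dense => //.
  have inj : {in W &, injective tau} by move=> u v _ _; apply: star_at_inj; apply: nZ.
  rewrite -(card_in_imset inj); apply/subset_leq_card/subsetP => c /imsetP[v vW ->].
  have /set0Pn[w] := hW v vW; rewrite !inE => /andP[/andP[wv /bigcupP[e ev we]] wW].
  move: ev; rewrite inE => /eqP ev.
  rewrite tauK; apply/exists_inP; exists e; first by rewrite inE ev.
  suff <- : [set v; w] = ve e.
    by apply/subsetP => y; rewrite !inE => /orP[] /eqP->.
  apply/eqP; rewrite eqEcard ve2 ?ev // cards2 eq_sym wv andbT.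
  by apply/subsetP => y; rewrite !inE => /orP[] /eqP-> //; apply: tauS.
- by apply/set0Pn; exists v0.
- by apply/forall_inP => v _; apply: subsetT.
- move=> v _; apply: leq_trans (cls3 (tauK v)) _.
  have inj : {in cls (tau v) &, injective ve}.
    move=> e1 e2; rewrite !inE => /eqP c1 /eqP c2; apply: simple.
    by rewrite c1 c2.
  rewrite -(card_in_imset inj).
  apply: leq_trans (leq_imset_card (fun u => [set v; u]) (out v)).
  apply/subset_leq_card/subsetP => f /imsetP[e]; rewrite inE => /eqP ev ->.
  have vv := tauS _ _ ev.
  have := ve2; move/(_ e); rewrite ev => /(_ (tauK v)).
  rewrite (cardsD1 v) vv => -[] /eqP/cards1P[u Eu].
  have fE' : ve e = [set v; u] by rewrite -(setD1K vv) Eu.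
  apply/imsetP; exists u => //.
  have : u \in ve e :\ v by rewrite Eu inE.
  by rewrite !inE => /andP[-> ue]; apply/bigcupP; exists e; rewrite ?inE ?ev.
Qed.

(** * Choice of a vertex that is the centre of no star colour *)

Definition nonstars : {set C} := [set c in K | ~~ [exists v, star c v]].
Definition bad (x : V) : {set C} := [set c in K | #|[set e in cls c | x \notin ve e]| == 1].

Lemma card_nonstars : #|K| = #|V| -> #|nonstars| <= #|noncentres|.
Proof.
move=> KV.
(* With no centre at all there is no default colour, but the bound is trivial. *)
have [ZT|[v0 v0Z]] := set_0Vmem (~: noncentres).
  have -> : noncentres = [set: V] by rewrite -[LHS]setCK ZT setC0.
  by rewrite cardsT -KV; apply/subset_leq_card/subsetP => c; rewrite inE => /andP[].
have [c0 _ _] : exists2 c, c \in K & star c v0.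
  by apply/exists_inP; move: v0Z; rewrite !inE negbK.
have inj : {in ~: noncentres &, injective (star_at c0)}.
  by move=> u v; rewrite !in_setC => uZ vZ; apply: star_at_inj.
have sub : star_at c0 @: (~: noncentres) \subset K :\: nonstars.
  apply/subsetP => c /imsetP[v]; rewrite in_setC => /(star_atP c0)[vK sv] ->.
  by rewrite !inE vK /= andbT negbK; apply/existsP; exists v.
have := subset_leq_card sub; rewrite (card_in_imset inj).
have nK : nonstars \subset K by apply/subsetP => c; rewrite inE => /andP[].
have := cardsID nonstars K; rewrite (setIidPr nK).
by have := cardsC noncentres; move: KV; clear; lia.
Qed.

Lemma card_avoid c x : #|[set e in cls c | x \in ve e]| + #|[set e in cls c | x \notin ve e]| = #|cls c|.
Proof.
rewrite -(cardsID [set e | x \in ve e] (cls c)); congr (_ + _); apply: eq_card => e.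
  by rewrite !inE.
by rewrite !inE andbC.
Qed.

(** A star centred at [v != x] has at most one edge through [x], so with a single edge avoiding [x]
    it would have at most two edges. *)
Lemma bad_nonstar x : x \in noncentres -> bad x \subset nonstars.
Proof.
move=> xZ; apply/subsetP => c; rewrite !inE => /andP[cK /eqP c1]; rewrite cK /=.
apply/negP => /existsP[v sv].
have vx : v != x.
  apply/eqP => vx; move: xZ; rewrite inE => /negP; apply; apply/exists_inP.
  by exists c => //; rewrite -vx.
have := card_avoid c x; rewrite c1.
suff : #|[set e in cls c | x \in ve e]| <= 1 by have := cls3 cK; clear; lia.
rewrite leqNgt; apply/negP => /card_gt1P[e1 [e2 []]].
rewrite !inE => /andP[/eqP k1 x1] /andP[/eqP k2 x2] /eqP; apply.
have sve e : col e = c -> v \in ve e.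
  by move/forall_inP: sv => /(_ e); rewrite inE => h /eqP.
by apply: same_colour_two_common vx (sve _ k1) x1 (sve _ k2) x2; rewrite ?k1 ?k2.
Qed.

(* A vertex bad for [c] lies on all edges of [c] but one, and the degrees add up to [2 * #|cls c|]. *)
Lemma card_bad_for c : c \in K -> #|[set x | c \in bad x]| <= 3.
Proof.
move=> cK; set X := [set x | c \in bad x].
have : \sum_(x in X) #|[set e in cls c | x \in ve e]| <= \sum_(x in [set: V]) #|[set e in cls c | x \in ve e]|.
  by rewrite [X in _ <= X](big_setID X) /= setTI leq_addr.
rewrite [X in _ <= X]sum_card_exchange.
have -> : \sum_(e in cls c) #|[set x in [set: V] | x \in ve e]| = \sum_(e in cls c) 2.
  apply: eq_bigr => e; rewrite inE => /eqP ec; rewrite -(@ve2 e) ?ec //.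
  by apply: eq_card => x; rewrite !inE.
have -> : \sum_(x in X) #|[set e in cls c | x \in ve e]| = \sum_(x in X) (#|cls c| - 1).
  apply: eq_bigr => x; rewrite !inE => /andP[_ /eqP c1].
  by rewrite -(card_avoid c x) c1 addnK.
by rewrite !sum_nat_const; have := cls3 cK; clear; nia.
Qed.

(** Double counting: four bad colours at each noncentre would exceed [3 * #|nonstars|], which is at
    most [3 * #|noncentres|]. *)
Lemma exists_few_bad : #|K| = #|V| -> noncentres != set0 ->
  exists2 x, x \in noncentres & #|bad x| <= 3.
Proof.
move=> KV Z0; apply/exists_inP; apply: contraT.
rewrite negb_exists_in => /forall_inP big4.
have h1 : #|noncentres| * 4 <= \sum_(x in noncentres) #|bad x|.
  by rewrite -sum_nat_const; apply: leq_sum => x /big4; rewrite -ltnNge.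
have h2 : \sum_(x in noncentres) #|bad x| <= #|nonstars| * 3.
  have -> : \sum_(x in noncentres) #|bad x| = \sum_(x in noncentres) #|[set c in nonstars | c \in bad x]|.
    apply: eq_bigr => x xZ; apply: eq_card => c; rewrite [RHS]inE.
    by case: (boolP (c \in bad x)) => [cb|]; rewrite ?andbF // (subsetP (bad_nonstar xZ)).
  rewrite sum_card_exchange -sum_nat_const; apply: leq_sum => c.
  rewrite inE => /andP[cK _]; apply: leq_trans (card_bad_for cK).
  by apply/subset_leq_card/subsetP => x; rewrite !inE => /andP[].
have := card_nonstars KV; move: Z0; rewrite -card_gt0; move: h1 h2; clear; lia.
Qed.

Lemma cols_noncentre x : x \in noncentres -> cols [set~ x] = K.
Proof.
move=> xZ; apply/setP => c; rewrite inE; case: (boolP (c \in K)) => //= cK.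
apply: contraT; rewrite negb_exists_in => /forall_inP sc.
move: xZ; rewrite inE => /negP[]; apply/exists_inP; exists c => //.
apply/forall_inP => e /sc; rewrite subsetC sub1set inE negbK //.
Qed.

(** * Minimal sets of positive excess and their complements *)

Definition multi (W : {set V}) : {set C} :=
  [set c in K | 2 <= #|[set e in cls c | ve e \subset W]|].

(* In a minimal set of positive excess, each vertex meets all the edges of at least two colours;
   a colour with two edges inside the set has at most one such vertex, others at most two. *)
Lemma card_multi (W : {set V}) : #|W| < #|cols W| ->
  (forall v, v \in W -> #|cols (W :\ v)| <= #|W :\ v|) -> #|multi W| <= 2.
Proof.
move=> exW minW.
have W0 : W != set0.
  apply: contraTneq exW => ->; rewrite cards0 -leqNgt leqn0 cards_eq0 -subset0.
  apply/subsetP => c /colsP[e ec /andP[cK]]; rewrite subset0 => /eqP e0.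
  by have := @ve2 e; rewrite ec cK e0 cards0 => /(_ isT).
have W3 : 3 <= #|W| by apply: leq_trans g3 (dense W0 (ltnW exW)).
pose cov v c := c \notin cols (W :\ v).
have h1 : #|W| * (#|cols W| - #|W| + 1) <= \sum_(v in W) #|[set c in cols W | cov v c]|.
  rewrite -sum_nat_const; apply: leq_sum => v vW.
  have -> : [set c in cols W | cov v c] = cols W :\: cols (W :\ v).
    by apply/setP => c; rewrite in_setD [LHS]in_set andbC.
  have := minW v vW; have := cardsID (cols (W :\ v)) (cols W).
  have := subset_leq_card (subsetIr (cols W) (cols (W :\ v))).
  by move: exW; rewrite [#|W|](cardsD1 v) vW; clear; lia.
have mW : multi W \subset cols W.
  apply/subsetP => c; rewrite !inE => /andP[-> /ltnW/card_gt0P[e]].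
  by rewrite inE => /andP[ec eW]; apply/exists_inP; exists e.
have cov_in e v c : col e = c -> ve e \subset W -> cov v c -> c \in K -> v \in ve e.
  move=> ec eW cv cK; apply: contraR cv => nve; apply/colsP; exists e => //.
  by rewrite cK subsetD1 eW.
have h2 : \sum_(v in W) #|[set c in cols W | cov v c]| + #|multi W| <= 2 * #|cols W|.
  rewrite sum_card_exchange (big_setID (multi W)) /= (setIidPr mW).
  have -> : 2 * #|cols W| = #|multi W| * 1 + #|cols W :\: multi W| * 2 + #|multi W|.
    by rewrite -(cardsID (multi W) (cols W)) (setIidPr mW); clear; lia.
  rewrite leq_add2r -!sum_nat_const; apply: leq_add; apply: leq_sum => c.
    rewrite inE => /andP[cK /card_gt1P[e1 [e2 []]]].
    rewrite !inE => /andP[/eqP k1 s1] /andP[/eqP k2 s2] ne.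
    rewrite leqNgt; apply/negP => /card_gt1P[u [v []]].
    rewrite !inE => /andP[_ cu] /andP[_ cv] uv.
    case/eqP: ne; apply: same_colour_two_common uv _ _ _ _;
      by [rewrite k1|rewrite k1 k2|apply: cov_in cu cK|apply: cov_in cv cK].
  rewrite inE => /andP[_ /colsP[e ec /andP[cK eW]]].
  rewrite -(@ve2 e) ?ec //; apply/subset_leq_card/subsetP => v.
  by rewrite inE => /andP[_ cv]; apply: cov_in cv cK.
(* With [e = #|cols W| - #|W|], the two counts give [#|multi W| <= 2 - (#|W| - 2) * (e - 1)]. *)
move: h1 h2 exW W3; clear; nia.
Qed.

Lemma bound_noncentre : #|K| = #|V| -> noncentres != set0 -> 9 * g <= 4 * #|V| + 50.
Proof.
move=> KV Z0; have [x xZ badx] := exists_few_bad KV Z0.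
have Vgt0 : 0 < #|V| by apply/card_gt0P; exists x.
pose P (W : {set V}) := (W \subset [set~ x]) && (#|W| < #|cols W|).
have [|W /andP[Wx exW] minW] := @exists_min_card _ P [set~ x].
  by rewrite /P subxx cols_noncentre // KV cardsC1 ltn_predL.
have xW : x \notin W by apply: contraL Wx => xW; apply/subsetPn; exists x; rewrite ?inE ?eqxx.
have mul2 : #|multi W| <= 2.
  apply: card_multi => // v vW; rewrite leqNgt; apply/negP => lt.
  have := minW (W :\ v); rewrite /P lt (subset_trans (subD1set _ _) Wx) => /(_ isT).
  by rewrite [X in X <= _](cardsD1 v) vW ltnn.
pose good e := (x \notin ve e) && ~~ (ve e \subset W).
(* All edges of such a colour that avoid [x] lie in [W]: two of them put the colour in [multi W], a
   single one in [bad x], hence at most [2 + 3] colours. *)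
pose Sp := [set c in K | ~~ [exists e in cls c, good e]].
have SpK : Sp \subset K by apply/subsetP => c; rewrite inE => /andP[].
have avoid_gt0 c : c \in K -> exists2 e, e \in cls c & x \notin ve e.
  rewrite -(cols_noncentre xZ) => /colsP[e ec /andP[_ ex]]; exists e; first by rewrite inE ec.
  by apply: contraL ex => xe; apply/subsetPn; exists x; rewrite ?inE ?eqxx.
have SpI c e : c \in Sp -> e \in cls c -> x \notin ve e -> ve e \subset W.
  rewrite inE negb_exists_in => /andP[_ /forall_inP h] ec xe.
  by have := h e ec; rewrite /good xe negbK.
have Sp5 : #|Sp| <= 5.
  have : Sp \subset multi W :|: bad x.
    apply/subsetP => c cS; have cK := subsetP SpK c cS; rewrite in_setU /bad /multi !in_set cK /=.
    have [e ec xe] := avoid_gt0 c cK.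
    have le : #|[set e in cls c | x \notin ve e]| <= #|[set e in cls c | ve e \subset W]|.
      apply/subset_leq_card/subsetP => e' /setIdP[ec' xe'].
      by apply/setIdP; split=> //; apply: SpI ec' xe'.
    have : 0 < #|[set e in cls c | x \notin ve e]|.
      by apply/card_gt0P; exists e; rewrite in_set ec.
    by move: le; case: #|_| => [|[|k]] //= le _; rewrite ?eqxx ?orbT // (leq_trans _ le).
  move/subset_leq_card/leq_trans; apply; apply: leq_trans (leq_card_setU _ _) _.
  by move: mul2 badx; clear; lia.
have [e0 _] : exists e : E, true.
  have [c cK] : exists c, c \in K by apply/card_gt0P; rewrite KV.
  by have [e _ _] := avoid_gt0 c cK; exists e.
pose sp_edge c := odflt e0 [pick e in cls c | x \notin ve e].
have sp_edgeP c : c \in Sp -> sp_edge c \in cls c /\ ve (sp_edge c) \subset W.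
  move=> cS; have [e ec xe] := avoid_gt0 c (subsetP SpK c cS).
  rewrite /sp_edge; case: pickP => [e' /andP[ec' xe']|/(_ e)]; last by rewrite ec xe.
  by split=> //; apply: SpI cS ec' xe'.
pose edge c := odflt e0 [pick e in cls c | good e].
have edgeP c : c \in K :\: Sp -> edge c \in cls c /\ good (edge c).
  rewrite in_setD in_set negb_and negbK => /andP[/orP[/negPf->//|/exists_inP[e ec ge]] cK].
  by rewrite /edge; case: pickP => [e' /andP[]|/(_ e)] //; rewrite ec ge.
(* What [W'] must borrow from [W] to contain the chosen edge: at most one vertex, as the edge leaves
   [W]. *)
pose key c := ve (edge c) :&: W.
have key1 c : c \in K :\: Sp -> #|key c| <= 1.
  move=> cS; have [ec /andP[_ nW]] := edgeP c cS.
  have : #|ve (edge c)| = 2.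
    apply: ve2; move: ec cS; rewrite in_set in_setD => /eqP-> /andP[//].
  rewrite -(cardsID W); have : 0 < #|ve (edge c) :\: W|.
    by have /subsetPn[y ye yW] := nW; apply/card_gt0P; exists y; rewrite in_setD yW.
  by rewrite -/(key c); clear; lia.
pose nu a := #|[set c in K :\: Sp | a \in key c]|.
(* The ends of one edge for each colour of [Sp] are forced into the selection, at most ten
   vertices. *)
pose A0 := \bigcup_(c in Sp) ve (sp_edge c).
have A0W : A0 \subset W by apply/bigcupsP => c /sp_edgeP[].
have A0le : #|A0| <= 10.
  have : #|A0| <= \sum_(c in Sp) #|ve (sp_edge c)|.
    rewrite /A0; elim/big_rec2: _ => [|c m B _ IH]; first by rewrite cards0.
    by apply: leq_trans (leq_card_setU _ _) _; rewrite leq_add2l.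
  have -> : \sum_(c in Sp) #|ve (sp_edge c)| = \sum_(c in Sp) 2.
    apply: eq_bigr => c cS; apply: ve2; have [] := sp_edgeP c cS.
    by rewrite in_set => /eqP-> _; apply: (subsetP SpK).
  by rewrite sum_nat_const; move: Sp5; clear; lia.
have [A [A0A AW sumA cardA]] := @greedy_selection _ nu _ _ A0W.
(* Colours whose chosen edge misses [W] need no selected vertex. *)
pose free := \sum_(c in K :\: Sp) (key c == set0).
have countW : free + \sum_(a in W) nu a = #|K :\: Sp|.
  rewrite /nu sum_card_exchange -big_split -sum1_card; apply: eq_bigr => c cS /=.
  have -> : [set a in W | a \in key c] = key c.
    by apply/setP => a; rewrite !in_set; case: (a \in W); rewrite ?andbT ?andbF.
  by have := key1 c cS; rewrite -cards_eq0; case: #|_| => [|[|]].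
have countA : free + \sum_(a in A) nu a <= #|[set c in K :\: Sp | key c \subset A]|.
  rewrite /nu sum_card_exchange -big_split -sum1dep_card big_mkcondr /=.
  apply: leq_sum => c cS.
  have [->|[a ak]] := set_0Vmem (key c).
    rewrite eqxx sub0set.
    by rewrite (eq_card (B := set0)) ?cards0 // => a; rewrite !in_set andbF.
  have kE : key c = [set a].
    by apply/esym/eqP; rewrite eqEcard sub1set ak cards1 key1.
  have -> : (key c == set0) = false by apply/negbTE/set0Pn; exists a.
  rewrite kE sub1set; case: (boolP (a \in A)) => aA.
    rewrite -[1](cards1 a); apply/subset_leq_card/subsetP => b.
    by rewrite in_set => /andP[].
  rewrite (eq_card (B := set0)) ?cards0 // => b; rewrite !inE.
  by apply/negP => /andP[bA /eqP ba]; move: aA; rewrite -ba bA.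
pose W' := (~: W :\ x) :|: A.
have cW' : #|W'| + 1 + #|W| = #|V| + #|A|.
  have dis : [disjoint ~: W :\ x & A].
    rewrite disjoints_subset; apply/subsetP => y; rewrite !in_set => /andP[_ yW].
    by apply: contra yW; apply: (subsetP AW).
  rewrite /W' cardsU (disjoint_setI0 dis) cards0 subn0 -(cardsC W).
  by rewrite [#|~: W|](cardsD1 x) in_setC xW; clear; lia.
have colsW' : #|Sp| + #|[set c in K :\: Sp | key c \subset A]| <= #|cols W'|.
  rewrite -[_ + _]subn0.
  have <- : #|Sp :&: [set c in K :\: Sp | key c \subset A]| = 0.
    by apply: eq_card0 => c; rewrite in_setI in_set in_setD; case: (c \in Sp).
  rewrite -cardsU; apply/subset_leq_card/subsetP => c; rewrite in_setU => /orP[cS|].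
    have [ec _] := sp_edgeP c cS; apply/colsP; exists (sp_edge c).
      by move: ec; rewrite in_set => /eqP.
    rewrite (subsetP SpK) //=; apply: subset_trans (subsetUr _ _).
    by apply: subset_trans A0A; apply: bigcup_sup.
  rewrite in_set => /andP[cS kA]; have [ec /andP[xe _]] := edgeP c cS.
  apply/colsP; exists (edge c); first by move: ec; rewrite in_set => /eqP.
  have /andP[_ ->] : (c \notin Sp) && (c \in K) by rewrite -in_setD.
  apply/subsetP => y ye; rewrite in_setU in_setD1 in_setC.
  case: (boolP (y \in W)) => yW; last by rewrite andbT; case: eqP ye xe => // -> ->.
  by apply/orP; right; apply: (subsetP kA); rewrite in_setI ye.
have KSp : #|Sp| + #|K :\: Sp| = #|K| by rewrite -(cardsID Sp K) (setIidPr SpK).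
(* By [sumA], restricting the keys from [W] to [A] loses at most [#|W| - #|A|] colours, while
   [#|W'| = #|V| - 1 - #|W| + #|A|]. *)
have exW' : #|W'| < #|cols W'|.
  by move: sumA countW countA cW' colsW' KSp KV; clear; lia.
(* Either bound on [#|A|] gives [#|W'| <= 2 * (#|V| - #|W|) + 19], so twice the bound for [W] plus
   the bound for [W'] cancels [#|W|]. *)
have := card_excess1_cols exW; have := card_excess1_cols exW'.
by move: sumA cardA countW cW' KSp KV A0le; clear; lia.
Qed.

End ColouredGraph.

(** * Extraction of a short rainbow cycle *)

Section RainbowCycle.
Variables (V E C : finType) (ends : E -> V * V) (col : E -> C) (K : {set C}).

Definition vertices (e : E) : {set V} := [set (ends e).1; (ends e).2].

Lemma joins_sym e u v : joins ends e u v -> joins ends e v u.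
Proof. by case; [right|left]. Qed.

Lemma joins_vertices e u v : joins ends e u v -> u \in vertices e /\ v \in vertices e.
Proof. by rewrite /vertices; case=> -> /=; rewrite !inE !eqxx orbT. Qed.

Lemma vertices_joins e u : u \in vertices e -> exists v, joins ends e u v.
Proof.
rewrite !inE => /orP[] /eqP ->; [exists (ends e).2; left|exists (ends e).1; right];
  by case: (ends e).
Qed.

Lemma joins_inj e u v u' v' : joins ends e u v -> joins ends e u' v' ->
  (u = u' /\ v = v') \/ (u = v' /\ v = u').
Proof. by rewrite /joins => -[] -> [] [-> ->]; [left|right|right|left]. Qed.

(** In a smallest such set choose one edge per colour. A singleton carries a loop; otherwise
    deleting a vertex loses at least two colours, so every vertex lies on two chosen edges, and
    extending a path at its head must eventually close a cycle. *)
Lemma exists_rainbow_cycle (W : {set V}) :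
  W != set0 -> #|W| <= #|cols vertices col K W| ->
  exists2 k, has_rainbow_cycle_of_length ends col k & k <= #|W|.
Proof.
move=> Wn0 leW.
pose P (A : {set V}) := [&& A != set0, A \subset W & #|A| <= #|cols vertices col K A|].
have [|A /and3P[A0 AW leA] minA] := @exists_min_card _ P W; first by rewrite /P Wn0 subxx.
suff [k hk kA] : exists2 k, has_rainbow_cycle_of_length ends col k & k <= #|A|.
  by exists k => //; apply: leq_trans kA (subset_leq_card AW).
have [v0 v0A] := set0Pn _ A0.
have [c0 c0A] : exists c, c \in cols vertices col K A.
  by apply/card_gt0P; apply: leq_trans leA; rewrite card_gt0.
have [e0 _ _] := colsP _ _ _ _ _ c0A.
pose eta c := odflt e0 [pick e in colour_class col c | vertices e \subset A].
have etaP c : c \in cols vertices col K A -> col (eta c) = c /\ vertices (eta c) \subset A.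
  case/colsP => e ec /andP[cK eA]; rewrite /eta; case: pickP => [e'|/(_ e)].
    by rewrite !inE => /andP[/eqP].
  by rewrite !inE ec eqxx eA.
have [A1|A1] := leqP #|A| 1.
  have AE : A = [set v0] by apply/esym/eqP; rewrite eqEcard sub1set v0A cards1.
  exists 1; last by rewrite AE cards1.
  have [_] := etaP c0 c0A; rewrite AE => /subsetP s.
  split=> //; exists (fun=> v0), (fun=> eta c0); split; first by case=> [|?] [].
  split; first by case=> [|?] [].
  move=> i _; left; have := s (ends (eta c0)).1; have := s (ends (eta c0)).2.
  rewrite !inE !eqxx orbT => /(_ isT)/eqP e2 /(_ isT)/eqP e1.
  by rewrite -{1}e1 -e2; case: (ends _).
pose D v := [set c in cols vertices col K A | v \in vertices (eta c)].
have deg2 v : v \in A -> 2 <= #|D v|.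
  move=> vA.
  have Av : #|A| = #|A :\ v|.+1 by rewrite (cardsD1 v) vA.
  have lt : #|cols vertices col K (A :\ v)| < #|A :\ v|.
    rewrite ltnNge; apply/negP => le.
    have Av0 : A :\ v != set0 by rewrite -card_gt0 -ltnS -Av.
    have := minA (A :\ v); rewrite /P Av0 le (subset_trans (subD1set _ _) AW) => /(_ isT).
    by rewrite Av ltnn.
  have sub : cols vertices col K A :\: D v \subset cols vertices col K (A :\ v).
    apply/subsetP => c; rewrite in_setD in_set negb_and => /andP[/orP[/negPf->//|vc] cA].
    have [ec eA] := etaP c cA; apply/colsP; exists (eta c) => //.
    by move: cA; rewrite inE => /andP[-> _]; rewrite subsetD1 eA.
  have DA : D v \subset cols vertices col K A by apply/subsetP => c; rewrite inE => /andP[].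
  have := subset_leq_card sub; have := cardsID (D v) (cols vertices col K A).
  by rewrite (setIidPr DA); move: leA lt Av; clear; lia.
pose jb u v c := (ends (eta c) == (u, v)) || (ends (eta c) == (v, u)).
have jbP u v c : reflect (joins ends (eta c) u v) (jb u v c).
  by apply: (iffP orP) => -[] /eqP; [left|right|left|right].
pose kc u v := odflt c0 [pick c in cols vertices col K A | jb u v c].
pose adj u v := [exists c in cols vertices col K A, jb u v c].
have kcP u v : adj u v -> kc u v \in cols vertices col K A /\ joins ends (eta (kc u v)) u v.
  move=> /exists_inP[c cA cj]; rewrite /kc; case: pickP => [c' /andP[? /jbP]|/(_ c)] //.
  by rewrite cA cj.
pose cyc := exists2 k, has_rainbow_cycle_of_length ends col k & k <= #|A|.
pose good s := [/\ uniq s, {subset s <= A} &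
  forall i, i.+1 < size s -> adj (nth v0 s i) (nth v0 s i.+1)].
have szA s : good s -> size s <= #|A|.
  move=> [us sA _]; rewrite -(card_uniqP us); apply: subset_leq_card.
  by apply/subsetP => v /sA.
suff ext j : cyc \/ exists2 s, good s & size s = j.+1.
  by case: (ext #|A|) => // -[s /szA + sz]; rewrite sz ltnn.
elim: j => [|j [cy|[s gs sz]]]; first 2 [by left].
  by right; exists [:: v0] => //; split=> // v; rewrite inE => /eqP->.
have [us sA sadj] := gs.
pose x := nth v0 s 0.
have xs : x \in s by rewrite mem_nth // sz.
(* A colour at the head [x] other than that of the first path edge. For a one-vertex path
   [nth v0 s 1] is the default [v0], and excluding one colour is harmless. *)
have [c cD cne] : exists2 c, c \in D x & c != kc x (nth v0 s 1).
  have := deg2 x (sA x xs); rewrite (cardsD1 (kc x (nth v0 s 1))) => h.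
  have /card_gt0P[c] : 0 < #|D x :\ kc x (nth v0 s 1)|.
    by move: h; case: (_ \in _); rewrite ?add1n ?add0n // => /ltnW.
  by rewrite !inE => /andP[cne cD]; exists c; rewrite ?inE.
have [cA xc] : c \in cols vertices col K A /\ x \in vertices (eta c).
  by move: cD; rewrite inE => /andP[].
have [ec eA] := etaP c cA.
have [y jxy] := vertices_joins xc.
have yA : y \in A by apply: (subsetP eA); have [] := joins_vertices jxy.
have [ys|ys] := boolP (y \in s); last first.
  right; exists (y :: s); last by rewrite /= sz.
  split; first by rewrite /= ys.
    by move=> v; rewrite inE => /orP[/eqP->|/sA].
  case=> [|i] /=; last exact: sadj.
  by move=> _; apply/exists_inP; exists c => //; apply/jbP/joins_sym.
left; pose m := index y s.
have ms : m < size s by rewrite index_mem.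
have ym : nth v0 s m = y by rewrite nth_index.
exists m.+1; last exact: leq_trans ms (szA s gs).
have nth_inj i i' : i < size s -> i' < size s -> nth v0 s i = nth v0 s i' -> i = i'.
  by move=> li li' /eqP; rewrite nth_uniq // => /eqP.
(* The cycle follows the path up to [y] and returns to [x] by the edge of colour [c]. *)
pose cc i := if i < m then kc (nth v0 s i) (nth v0 s i.+1) else c.
have ccP i : i <= m -> cc i \in cols vertices col K A /\
    joins ends (eta (cc i)) (nth v0 s i) (nth v0 s (i.+1 %% m.+1)).
  rewrite leq_eqVlt /cc => /orP[/eqP->|im].
    by rewrite ltnn modnn ym; split=> //; apply: joins_sym.
  by rewrite im modn_small //; apply: kcP; apply: sadj; apply: leq_ltn_trans ms.
split=> //; exists (nth v0 s), (fun i => eta (cc i)); split.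
  by move=> i i' /= im im'; apply: nth_inj; apply: leq_trans ms.
split; last by move=> i im; have [] := ccP i im.
suff cc_inj i i' : i < i' -> i' <= m -> cc i <> cc i'.
  move=> i i'; rewrite !inE !ltnS => im im' /=.
  have [/etaP[-> _] _] := ccP i im; have [/etaP[-> _] _] := ccP i' im'.
  by case: (ltngtP i i') => // lt eqc; [case: (cc_inj i i')|case: (cc_inj i' i)].
move=> lt le eqc.
have im : i < m := leq_trans lt le.
have [_ ji] := ccP i (ltnW im); have [_] := ccP i' le; rewrite -eqc => ji'.
have isz : i.+1 < size s := leq_ltn_trans im ms.
rewrite modn_small // in ji.
(* A repeated edge would join the same two vertices, which forces a cycle of length two; there [c]
   was chosen different from the other colour. *)
case: (joins_inj ji ji') => -[e1 e2].
  by have := nth_inj _ _ (ltnW isz) (leq_ltn_trans le ms) e1; move: lt; clear; lia.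
have e2' := nth_inj _ _ isz (leq_ltn_trans le ms) e2.
have i'm : i'.+1 %% m.+1 < size s by apply: leq_ltn_trans ms; rewrite -ltnS ltn_mod.
have e1' := nth_inj _ _ (ltnW isz) i'm e1.
have [i'm1|i'm1] := ltnP i' m.
  by move: e1'; rewrite modn_small // -e2'; clear; lia.
have mi' : m = i' by apply/eqP; rewrite eqn_leq i'm1 le.
move: e1'; rewrite -mi' modnn => i0.
move: eqc cne; rewrite /cc im -mi' ltnn i0 => ->.
by rewrite eqxx.
Qed.

End RainbowCycle.

(** * Reduction to exactly [n] colours and conclusion *)

Lemma exists_subset_card (T : finType) (A : {set T}) n : n <= #|A| ->
  exists2 B : {set T}, B \subset A & #|B| = n.
Proof.
move=> nA; exists [set x in take n (enum A)].
  by apply/subsetP => x; rewrite inE => /mem_take; rewrite mem_enum.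
rewrite cardsE (card_uniqP _) ?take_uniq ?enum_uniq // size_takel //.
by rewrite -cardE.
Qed.

Theorem theorem3p1 (n : nat) (V E C : finType)
    (ends : E -> V * V) (col : E -> C) :
  1 <= n ->
  #|V| = n ->
  simple_coloured ends col ->
  n <= #|colours_used col| ->
  (forall c, c \in colours_used col -> 3 <= #|colour_class col c|) ->
  exists k, has_rainbow_cycle_of_length ends col k /\ 9 * k <= 4 * n + 63.
Proof.
move=> n1 Vn simp nC cls3.
have [K KC Kn] := exists_subset_card nC.
(* The least [g] with [9 * g > 4 * n + 63]: a cycle on fewer than [g] vertices is short enough, and
   the bounds of both cases below are contradictory. *)
pose g := ((4 * n + 63) %/ 9).+1.
pose ve := vertices ends.
have [/existsP[W /and3P[W0 leW ltW]]|nW] :=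
  boolP [exists W : {set V}, [&& W != set0, #|W| <= #|cols ve col K W| & #|W| < g]].
  have [k hk kW] := exists_rainbow_cycle W0 leW.
  by exists k; split=> //; move: kW ltW; rewrite /g; clear; lia.
have dense (W : {set V}) : W != set0 -> #|W| <= #|cols ve col K W| -> g <= #|W|.
  move=> W0 leW; rewrite leqNgt; apply/negP => ltW.
  by move: nW; rewrite negb_exists => /forallP/(_ W); rewrite W0 leW ltW.
have g3 : 3 <= g by rewrite /g; clear; lia.
(* A loop of a kept colour would make its vertex a singleton violating [dense]. *)
have ve2 e : col e \in K -> #|ve e| = 2.
  move=> eK; rewrite cards2; case: eqP => // e12.
  have e1 : ve e = [set (ends e).1] by rewrite /ve /vertices e12 setUid.
  have : g <= #|ve e|.
    apply: dense; first by rewrite e1 -card_gt0 cards1.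
    rewrite e1 cards1; apply/card_gt0P; exists (col e); apply/colsP; exists e => //.
    by rewrite eK -e1 subxx.
  by rewrite e1 cards1; move: g3; clear; lia.
have simple e1 e2 : col e1 = col e2 -> ve e1 = ve e2 -> e1 = e2.
  move=> ec ev; apply/eqP; apply: contraT => /eqP ne; case: (simp e1 e2 ec); split=> //.
  move: ev; rewrite /ve /vertices /joins; case: (ends e1) (ends e2) => a b [a' b'] /= ev.
  have : a' \in [set a; b] by rewrite ev !inE eqxx.
  have : b' \in [set a; b] by rewrite ev !inE eqxx orbT.
  have : a \in [set a'; b'] by rewrite -ev !inE eqxx.
  have : b \in [set a'; b'] by rewrite -ev !inE eqxx orbT.
  rewrite !inE; do 4![case/orP => /eqP ?]; subst; by [left|right].
have cls3' c : c \in K -> 3 <= #|colour_class col c| by move/(subsetP KC)/cls3.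
have [v0 _] : exists v : V, true by have /card_gt0P[v _] : 0 < #|V| by [rewrite Vn]; exists v.
have KV : #|K| = #|V| by rewrite Kn Vn.
have [Z0|Z0] := eqVneq (noncentres ve col K) set0.
  have := bound_all_centres ve2 simple cls3' dense v0 Z0.
  by rewrite Vn /g; clear; lia.
have := bound_noncentre g3 ve2 simple cls3' dense KV Z0.
by rewrite Vn /g; clear; lia.
Qed.
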